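(* If $\bar x$ is a local optimal solution of the problem $\min_{x\in X}\varphi(x)$ (i.e. $\bar x\in X$ and there is a neighborhood $U$ of $\bar x$ with $\varphi(\bar x)\le\varphi(x)$ for all $x\in U\cap X$), then $\bar x$ is stationary for the minmax problem $(P)$.
   Context: Let $Q_{11}\in\mathbb{R}^{n\times n}$, $Q_{22}\in\mathbb{R}^{m\times m}$ be symmetric positive semidefinite, $Q_{12}\in\mathbb{R}^{n\times m}$, $c_x\in\mathbb{R}^n$, $c_y\in\mathbb{R}^m$, $A_O\in\mathbb{R}^{p\times n}$, $b_O\in\mathbb{R}^p$, $A_I\in\mathbb{R}^{q\times n}$, $B_I\in\mathbb{R}^{q\times m}$, $b_I\in\mathbb{R}^q$ with $p<n$, $q<m$. Put $f(x,y)=\frac12x^\top Q_{11}x+x^\top Q_{12}y-\frac12y^\top Q_{22}y+c_x^\top x+c_y^\top y$, $X=\{x\in\mathbb{R}^n: A_Ox=b_O,\ x\ge0\}$, $Y(x)=\{y\in\mathbb{R}^m: A_Ix+B_Iy=b_I,\ y\ge0\}$ (componentwise inequalities). Problem $(P)$ is $\min_{x\in X}\max_{y\in Y(x)}f(x,y)$. Let $S(x)=\arg\max_{y\in Y(x)}f(x,y)$; standing assumption: $S(x)\ne\emptyset$ for all $x\in X$. Let $\varphi(x)=\max_{y\in Y(x)}f(x,y)$. A point $\bar x\in X$ is called stationary for $(P)$ if for some $\bar y\in S(\bar x)$ there exist $(\bar\lambda_O,\bar s_O)\in\mathbb{R}^p\times\mathbb{R}^n$ and $(\bar\lambda_I,\bar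 s_I)\in\mathbb{R}^q\times\mathbb{R}^m$ such that $(x,y,\lambda_O,s_O,\lambda_I,s_I)=(\bar x,\bar y,\bar\lambda_O,\bar s_O,\bar\lambda_I,\bar s_I)$ solves ($\circ$ is the componentwise product) $Q_{11}x+Q_{12}y+c_x+A_I^\top\lambda_I+A_O^\top\lambda_O-s_O=0$, $A_Ox-b_O=0$, $x\circ s_O=0$, $x,s_O\ge0$ (outer KKT system), and $-Q_{22}y+Q_{12}^\top x+c_y+B_I^\top\lambda_I+s_I=0$, $A_Ix+B_Iy-b_I=0$, $y\circ s_I=0$, $y,s_I\ge0$ (inner KKT system). *)

(* Defs.v *)
From mathcomp Require Import all_boot all_order all_algebra.
From mathcomp Require Import all_classical all_reals all_analysis.

Set Implicit Arguments.
Unset Strict Implicit.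
Unset Printing Implicit Defensive.

Import Order.TTheory GRing.Theory Num.Theory.
Import numFieldNormedType.Exports.

Local Open Scope classical_set_scope.
Local Open Scope ring_scope.

Definition dot (R : realType) (k : nat) (u v : 'cV[R]_k) : R := (u^T *m v) 0 0.

Definition sym_psd (R : realType) (k : nat) (M : 'M[R]_k) : Prop :=
  M^T = M /\ forall u : 'cV[R]_k, 0 <= dot u (M *m u).

Definition nonneg (R : realType) (k : nat) (u : 'cV[R]_k) : Prop :=
  forall i, 0 <= u i 0.

Definition hadamard (R : realType) (k : nat) (u v : 'cV[R]_k) : 'cV[R]_k :=
  map2_mx *%R u v.

Record minmax_qp (R : realType) (n m p q : nat) := MinmaxQP {
  Q11 : 'M[R]_n;
  Q22 : 'M[R]_m;
  Q12 : 'M[R]_(n, m);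
  c_x : 'cV[R]_n;
  c_y : 'cV[R]_m;
  A_O : 'M[R]_(p, n);
  b_O : 'cV[R]_p;
  A_I : 'M[R]_(q, n);
  B_I : 'M[R]_(q, m);
  b_I : 'cV[R]_q
}.

Section Minmax.
Variables (R : realType) (n m p q : nat) (P : minmax_qp R n m p q).

Definition objective (x : 'cV[R]_n) (y : 'cV[R]_m) : R :=
  2^-1 * dot x (Q11 P *m x) + dot x (Q12 P *m y) - 2^-1 * dot y (Q22 P *m y)
  + dot (c_x P) x + dot (c_y P) y.

Definition outer_feasible : set 'cV[R]_n :=
  [set x | A_O P *m x = b_O P /\ nonneg x].

Definition inner_feasible (x : 'cV[R]_n) : set 'cV[R]_m :=
  [set y | A_I P *m x + B_I P *m y = b_I P /\ nonneg y].

Definition inner_argmax (x : 'cV[R]_n) : set 'cV[R]_m :=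
  [set y | inner_feasible x y /\
           forall z, inner_feasible x z -> objective x z <= objective x y].

(* [sup] has a default value on empty or unbounded sets; it is the maximum as
   soon as [inner_argmax x] is nonempty, see [value_function_max]. *)
Definition value_function (x : 'cV[R]_n) : R :=
  sup [set objective x y | y in inner_feasible x].

Lemma value_function_max (x : 'cV[R]_n) (y : 'cV[R]_m) :
  inner_argmax x y -> value_function x = objective x y.
Proof.
move=> [Yy ymax]; apply/eqP; rewrite eq_le; apply/andP; split.
  by apply: ge_sup => [|_ [z Yz <-]]; [exists (objective x y), y | exact: ymax].
apply: ub_le_sup; last by exists y.
by exists (objective x y) => _ [z Yz <-]; exact: ymax.
Qed.

Definition local_solution (xb : 'cV[R]_n) : Prop :=
  outer_feasible xb /\
  \forall x \near xb, outer_feasible x -> value_function xb <= value_function x.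

Definition outer_KKT (x : 'cV[R]_n) (y : 'cV[R]_m) (lO : 'cV[R]_p)
    (sO : 'cV[R]_n) (lI : 'cV[R]_q) : Prop :=
  [/\ Q11 P *m x + Q12 P *m y + c_x P + (A_I P)^T *m lI + (A_O P)^T *m lO - sO
        = 0,
      A_O P *m x - b_O P = 0,
      hadamard x sO = 0,
      nonneg x & nonneg sO].

Definition inner_KKT (x : 'cV[R]_n) (y : 'cV[R]_m) (lI : 'cV[R]_q)
    (sI : 'cV[R]_m) : Prop :=
  [/\ - (Q22 P *m y) + (Q12 P)^T *m x + c_y P + (B_I P)^T *m lI + sI = 0,
      A_I P *m x + B_I P *m y - b_I P = 0,
      hadamard y sI = 0,
      nonneg y & nonneg sI].

Definition stationary (xb : 'cV[R]_n) : Prop :=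
  outer_feasible xb /\
  exists2 yb, inner_argmax xb yb &
  exists lO sO lI sI, outer_KKT xb yb lO sO lI /\ inner_KKT xb yb lI sI.

End Minmax.

(* Main.v *)
Require Import Defs.
From mathcomp Require Import all_boot all_order all_algebra.
From mathcomp Require Import all_classical all_reals all_analysis.
From mathcomp Require Import ring lra.
Local Open Scope classical_set_scope.

(** Near [xb] the value function is bounded above by dual bounds that are
quadratic along rays. At a local minimum no bound of this kind that is tight at
[xb] decreases to first order, and Farkas' lemma turns this into stationarity.

For fixed [x] the inner problem is a concave quadratic programme; Dorn's dual
bounds its value by [inner_dual x v l] for every [v] and [l] with
[inner_slack x v l >= 0] ([weak_duality]). Let [y0] be a maximiser at [xb] and
let [(l, s)] be multipliers for it ([inner_multipliers], by Farkas' lemma), so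
that [s] is the slack at [(xb, y0, l)] and the bound is tight there. Keep
[(l, s)] fixed and look for a [y], possibly different from [y0], that together
with [(l, s)] makes [xb] stationary. The points [y >= 0] with
[A_I xb + B_I y = b_I], [Q22 y = Q22 y0] and [y] complementary to [s] satisfy
the inner KKT system with these same multipliers, hence are maximisers
([inner_KKT_argmax]); on them the outer KKT system is linear in [y], [lO] and
[sO]. All requirements thus form one linear system, with some unknowns
nonnegative and some forced to vanish.

If that system has no solution, Farkas' lemma gives [(d, w, mu)] such that [d]
is a feasible direction at [xb], the point [(y0 + t w, l + t mu)] stays dual
feasible at [xb + t d] for small [t > 0], and the bound [inner_dual] has
negative slope along this ray ([stationary_system_solvable]). Since [xb + t d]
lies in [X], the inner maximum is attained there and is at most the dual bound,
which is smaller than the value at [xb]: this contradicts local optimality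
([inner_dual_slope_ge0]). *)

Set Implicit Arguments.
Unset Strict Implicit.
Unset Printing Implicit Defensive.

Import Order.TTheory GRing.Theory Num.Theory.
Import numFieldNormedType.Exports.

Local Open Scope ring_scope.

(** * Scalar products *)

Section Dot.
Variable R : realType.

Lemma dotE k (u v : 'cV[R]_k) : dot u v = \sum_i u i 0 * v i 0.
Proof. by rewrite /dot mxE; apply: eq_bigr => i _; rewrite mxE. Qed.

Lemma dotC k (u v : 'cV[R]_k) : dot u v = dot v u.
Proof. by rewrite !dotE; apply: eq_bigr => i _; rewrite mulrC. Qed.

Lemma dotDr k (u v w : 'cV[R]_k) : dot u (v + w) = dot u v + dot u w.
Proof. by rewrite /dot mulmxDr mxE. Qed.

Lemma dotZr k a (u v : 'cV[R]_k) : dot u (a *: v) = a * dot u v.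
Proof. by rewrite /dot -scalemxAr mxE. Qed.

Lemma dotNr k (u v : 'cV[R]_k) : dot u (- v) = - dot u v.
Proof. by rewrite -scaleN1r dotZr mulN1r. Qed.

Lemma dotDl k (u v w : 'cV[R]_k) : dot (u + v) w = dot u w + dot v w.
Proof. by rewrite ![dot _ w]dotC dotDr. Qed.

Lemma dotZl k a (u v : 'cV[R]_k) : dot (a *: u) v = a * dot u v.
Proof. by rewrite ![dot _ v]dotC dotZr. Qed.

Lemma dotNl k (u v : 'cV[R]_k) : dot (- u) v = - dot u v.
Proof. by rewrite ![dot _ v]dotC dotNr. Qed.

Lemma dot0r k (u : 'cV[R]_k) : dot u 0 = 0.
Proof. by rewrite /dot mulmx0 mxE. Qed.

Definition dot_linear := (dotDl, dotDr, dotNl, dotNr, dotZl, dotZr).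

Lemma dot_adjoint k l (M : 'M[R]_(k, l)) u v :
  dot u (M *m v) = dot (M^T *m u) v.
Proof. by rewrite /dot trmx_mul trmxK mulmxA. Qed.

Lemma dot_col_mx k l (u v : 'cV[R]_k) (u' v' : 'cV[R]_l) :
  dot (col_mx u u') (col_mx v v') = dot u v + dot u' v'.
Proof. by rewrite /dot tr_col_mx mul_row_col mxE. Qed.

Lemma dot_sumr (I : Type) (r : seq I) k (u : 'cV[R]_k) (x : I -> R)
    (a : I -> 'cV[R]_k) :
  dot u (\sum_(i <- r) x i *: a i) = \sum_(i <- r) x i * dot u (a i).
Proof.
elim: r => [|i r IHr]; first by rewrite !big_nil dot0r.
by rewrite !big_cons dotDr dotZr IHr.
Qed.

Lemma dot_ge0 k (u v : 'cV[R]_k) : nonneg u -> nonneg v -> 0 <= dot u v.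
Proof.
by move=> u0 v0; rewrite dotE; apply: sumr_ge0 => i _; exact: mulr_ge0.
Qed.

Lemma hadamard_dot0 k (u v : 'cV[R]_k) : hadamard u v = 0 -> dot u v = 0.
Proof.
move=> uv0; rewrite dotE big1 // => i _.
by move/matrixP/(_ i 0): uv0; rewrite !mxE.
Qed.

End Dot.

(** * Farkas' lemma *)

Section Farkas.
Variable R : realType.

(** Induction on the generators of the cone (Bartl's argument): if [zb]
separates [b] from all generators but [a j], every vector is projected along
[a j] onto the hyperplane orthogonal to [zb], which removes [a j]. A conic
representation of the projection of [b] lifts back with a nonnegative
coefficient on [a j] because [zb] separates; a separating vector [z] lifts back
by subtracting the multiple of [zb] that makes it orthogonal to [a j]. The
columns of [A], whose coefficients are free, only enter the base case, where
the claim is that a vector outside a subspace is not orthogonal to its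
orthogonal complement. *)
Lemma farkas_cone (I : eqType) k l (A : 'M[R]_(k, l)) (r : seq I)
    (a : I -> 'cV[R]_k) (b : 'cV[R]_k) : uniq r ->
  (exists u, exists2 x : I -> R, forall i, 0 <= x i
      & b = A *m u + \sum_(i <- r) x i *: a i) \/
  (exists z, [/\ A^T *m z = 0, forall i, i \in r -> dot z (a i) <= 0
      & 0 < dot z b]).
Proof.
elim: r a b => [|j r IHr] a b /=.
  move=> _; have [/submxP[u bE]|] := boolP (b^T <= A^T)%MS.
    left; exists u^T; exists (fun=> 0) => //.
    by rewrite big_nil addr0 -[b]trmxK bE trmx_mul trmxK.
  rewrite submxE => /rowV0Pn[_ /submxP[v ->]] nz.
  have [i bi] : exists i, (b^T *m cokermx A^T) 0 i != 0.
    apply/existsP; rewrite -negb_forall; apply: contraNN nz => /forallP b0.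
    suff -> : b^T *m cokermx A^T = 0 by rewrite mulmx0.
    by apply/rowP => i; rewrite [RHS]mxE; apply/eqP.
  pose w := col i (cokermx A^T).
  have Aw : A^T *m w = 0 by rewrite /w colE mulmxA mulmx_coker mul0mx.
  have bw : dot w b != 0 by rewrite dotC /dot /w colE mulmxA -colE mxE.
  (* With the factor [dot w b] the product with [b] is a square. *)
  right; exists (dot w b *: w); split=> //.
    by rewrite -scalemxAr Aw scaler0.
  by rewrite dotZl -expr2 lt_neqAle sqr_ge0 eq_sym sqrf_eq0 bw.
move=> /andP[jr ur].
have [[u [x x0 bE]]|[zb [Azb zba zbb]]] := IHr a b ur.
  left; exists u; exists (fun i => if i == j then 0 else x i).
    by move=> i; case: eqP.
  rewrite big_cons eqxx scale0r add0r bE; congr (_ + _).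
  by apply: eq_big_seq => i ir; case: eqP => // ij; rewrite -ij ir in jr.
have [aj_le0|aj_gt0] := leP (dot zb (a j)) 0.
  right; exists zb; split=> // i; rewrite inE => /predU1P[->//|]; exact: zba.
set al := dot zb (a j) in aj_gt0.
pose proj v := v - (dot zb v / al) *: a j.
have [[u [x x0 bE]]|[z [Az za zb']]] := IHr (fun i => proj (a i)) (proj b) ur.
  (* [c] is the coefficient of [a j] left over once [b] and the [a i] are no
     longer projected. *)
  pose c := (dot zb b - \sum_(i <- r) x i * dot zb (a i)) / al.
  have c0 : 0 <= c.
    apply: divr_ge0; last exact: ltW.
    rewrite subr_ge0; apply: le_trans (ltW zbb).
    rewrite big_seq; apply: sumr_le0 => i ir.
    by apply: mulr_ge0_le0; [exact: x0|exact: zba].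
  left; exists u; exists (fun i => if i == j then c else x i).
    by move=> i; case: eqP.
  rewrite big_cons eqxx.
  have -> : \sum_(i <- r) (if i == j then c else x i) *: a i =
            \sum_(i <- r) x i *: a i.
    by apply: eq_big_seq => i ir; case: eqP => // ij; rewrite -ij ir in jr.
  have bE' : b = A *m u + \sum_(i <- r) x i *: proj (a i) +
                 (dot zb b / al) *: a j by rewrite -bE /proj subrK.
  rewrite [LHS]bE' /c mulrBl scalerBl -!addrA; congr (_ + _).
  rewrite [RHS]addrCA [RHS]addrA [RHS]addrC [RHS]addrA; congr (_ + _).
  rewrite mulr_suml scaler_suml -sumrB; apply: eq_bigr => i _.
  by rewrite /proj scalerBr scalerA mulrA.
(* Pairing this vector with [v] is pairing [z] with the projection of [v]. *)
right; exists (z - (dot z (a j) / al) *: zb).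
have projE v : dot (z - (dot z (a j) / al) *: zb) v = dot z (proj v).
  by rewrite /proj !dot_linear; ring.
split.
- by rewrite mulmxBr -scalemxAr Azb Az scaler0 subr0.
- move=> i; rewrite projE inE => /predU1P[->|]; last exact: za.
  by rewrite /proj divff ?gt_eqF// scale1r subrr dot0r.
- by rewrite projE.
Qed.

(** The form used for KKT systems: [J] is the set of indices at which the
nonnegative unknown may be nonzero, so that complementarity with a given vector
is a linear condition. *)
Lemma farkas k l c (A : 'M[R]_(k, l)) (B : 'M[R]_(k, c)) (J : pred 'I_c)
    (b : 'cV[R]_k) :
  (exists u x, [/\ nonneg x, forall j, ~~ J j -> x j 0 = 0
      & A *m u + B *m x = b]) \/
  (exists z, [/\ A^T *m z = 0, forall j, J j -> (B^T *m z) j 0 <= 0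
      & 0 < dot z b]).
Proof.
have [[u [x x0 bE]]|[z [Az zB zb]]] :=
    farkas_cone A (fun j => col j B) b (enum_uniq J).
  left; exists u; exists (\col_j if J j then x j else 0); split.
  - by move=> j; rewrite mxE; case: ifP.
  - by move=> j /negbTE Jj; rewrite mxE Jj.
  - rewrite bE; congr (_ + _); apply/colP => i; rewrite mxE summxE.
    rewrite big_enum_cond /= [RHS]big_mkcond; apply: eq_bigr => j _ /=.
    rewrite !mxE -topredE /=; case: (J j) => /=; last by rewrite mulr0.
    by rewrite mulrC.
right; exists z; split=> // j Jj.
have -> : (B^T *m z) j 0 = dot z (col j B).
  by rewrite dotE mxE; apply: eq_bigr => i _; rewrite !mxE mulrC.
by apply: zB; rewrite mem_enum.
Qed.

End Farkas.

(** * Small steps along a ray *)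

Section Rays.
Variable R : realType.

Lemma near_gt0_affine (a c : R) : 0 < a -> \forall t \near 0^'+, 0 < a + t * c.
Proof.
move=> a0; have cv : a + t * c @[t --> (0:R)^'+] --> a.
  rewrite -[X in _ --> X]addr0 -[X in _ --> _ + X](mul0r c).
  apply: cvg_at_right_filter; apply: cvgD; first exact: cvg_cst.
  by apply: cvgM; [exact: cvg_id | exact: cvg_cst].
exact: (cvgr_gt _ cv).
Qed.

Lemma near_nonneg_ray k (u d : 'cV[R]_k) : nonneg u ->
    (forall i, u i 0 = 0 -> 0 <= d i 0) ->
  \forall t \near 0^'+, nonneg (u + t *: d).
Proof.
move=> u0 d0; apply: filter_forall => i.
have [ui0|ui0] := eqVneq (u i 0) 0.
  near=> t; rewrite !mxE ui0 add0r mulr_ge0 ?d0//.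
have : \forall t \near 0^'+, 0 < u i 0 + t * d i 0.
  by apply: near_gt0_affine; rewrite lt_neqAle eq_sym ui0 u0.
by apply: filterS => t /ltW; rewrite !mxE.
Unshelve. all: by end_near. Qed.

Lemma near_ray k (x d : 'cV[R]_k) (S : set 'cV[R]_k) :
  nbhs x S -> \forall t \near 0^'+, S (x + t *: d).
Proof.
suff cv : x + t *: d @[t --> (0:R)^'+] --> x by move=> xS; exact: cv.
suff : x + t *: d @[t --> (0:R)^'+] --> x + 0 *: d by rewrite scale0r addr0.
apply: cvg_at_right_filter; apply: cvgD; first exact: cvg_cst.
by apply: cvgZr_tmp; exact: cvg_id.
Qed.

End Rays.

(** * Duality for the inner problem *)

Section Minmax.
Variables (R : realType) (n m p q : nat) (P : minmax_qp R n m p q).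
Hypothesis psdQ22 : sym_psd (Q22 P).

(** Minus the gradient in [y], at [y = v], of the inner Lagrangian. *)
Definition inner_slack (x : 'cV[R]_n) (v : 'cV[R]_m) (l : 'cV[R]_q) :
    'cV[R]_m :=
  Q22 P *m v - (Q12 P)^T *m x - c_y P - (B_I P)^T *m l.

(** Dorn's dual objective of the inner quadratic programme. *)
Definition inner_dual (x : 'cV[R]_n) (v : 'cV[R]_m) (l : 'cV[R]_q) : R :=
  2^-1 * dot x (Q11 P *m x) + dot (c_x P) x + dot l (A_I P *m x - b_I P)
  + 2^-1 * dot v (Q22 P *m v).

(** Both weak duality and the optimality of KKT points are read off this
identity: its right-hand side is nonnegative under dual feasibility, and
vanishes for [v = y] under complementarity. *)
Lemma dual_gap (x : 'cV[R]_n) (y v : 'cV[R]_m) (l : 'cV[R]_q) :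
    A_I P *m x + B_I P *m y = b_I P ->
  inner_dual x v l - objective P x y =
    dot y (inner_slack x v l) + 2^-1 * dot (y - v) (Q22 P *m (y - v)).
Proof.
have [symQ _] := psdQ22.
rewrite /inner_dual /objective /inner_slack => <-.
rewrite !mulmxDr !mulmxN !dot_linear.
rewrite (dot_adjoint (Q22 P) v y) symQ (dotC (_ *m v) y).
rewrite (dot_adjoint (Q12 P) x y) (dotC (_ *m x) y).
rewrite (dot_adjoint (B_I P) l y) (dotC (_ *m l) y) (dotC (c_y P)).
by field.
Qed.

Lemma weak_duality x y v l : inner_feasible P x y ->
  nonneg (inner_slack x v l) -> objective P x y <= inner_dual x v l.
Proof.
move=> [yE y0] s0; rewrite -subr_ge0 dual_gap//.
by rewrite addr_ge0 ?dot_ge0// mulr_ge0 ?invr_ge0//; case: psdQ22.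
Qed.

Lemma inner_KKT_slack x y l s : inner_KKT P x y l s -> s = inner_slack x y l.
Proof.
case=> + _ _ _ _ => /eqP; rewrite addrC addr_eq0 => /eqP ->.
by rewrite /inner_slack !opprD opprK.
Qed.

Lemma inner_KKT_dual x y l s :
  inner_KKT P x y l s -> inner_dual x y l = objective P x y.
Proof.
move=> kkt; have sE := inner_KKT_slack kkt.
case: kkt => _ /eqP + ys _ _; rewrite subr_eq0 => /eqP yE.
apply/eqP; rewrite -subr_eq0 dual_gap// -sE (hadamard_dot0 ys) add0r.
by rewrite subrr mulmx0 dot0r mulr0.
Qed.

Lemma inner_KKT_argmax x y l s : inner_KKT P x y l s -> inner_argmax P x y.
Proof.
move=> kkt; have sE := inner_KKT_slack kkt; have dE := inner_KKT_dual kkt.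
case: kkt => _ /eqP + _ y0 s0; rewrite subr_eq0 => /eqP yE.
split=> // z zY; rewrite -dE; apply: weak_duality => //.
by rewrite -sE.
Qed.

Lemma objective_ray x y d t :
  objective P x (y + t *: d) = objective P x y
    + t * dot d ((Q12 P)^T *m x + c_y P - Q22 P *m y)
    - t ^+ 2 / 2 * dot d (Q22 P *m d).
Proof.
have [symQ _] := psdQ22.
rewrite /objective !mulmxDr -!scalemxAr !dot_linear.
rewrite (dot_adjoint (Q22 P) y d) symQ (dotC (_ *m y) d).
rewrite (dot_adjoint (Q12 P) x d) (dotC (_ *m x) d) (dotC (c_y P) d).
by field.
Qed.

(** If the KKT system had no multipliers, the vector given by Farkas' lemma
would be, up to sign, a direction of ascent; as the constraints are affine, small
steps along it stay feasible. *)
Lemma inner_multipliers x y :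
  inner_argmax P x y -> exists l s, inner_KKT P x y l s.
Proof.
move=> [[yE y0] ymax].
pose g := (Q12 P)^T *m x + c_y P - Q22 P *m y.
have [[l [s [s0 sJ E]]]|[z [Bz zJ zg]]] :=
    farkas (B_I P)^T 1%:M (fun j => y j 0 == 0) (- g).
  exists l, s; split=> //; last 1 first.
  - apply/matrixP=> i j; rewrite !mxE ord1.
    by have [->|/sJ->] := eqVneq (y i 0) 0; rewrite ?mul0r ?mulr0.
  - move: E; rewrite mul1mx => E.
    have -> : - (Q22 P *m y) + (Q12 P)^T *m x + c_y P = g.
      by rewrite /g [RHS]addrC addrA.
    by rewrite -addrA E addrN.
  - by rewrite yE subrr.
exfalso.
have [t [t0 y't gt]] : exists t, [/\ 0 < t, nonneg (y + t *: - z)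
     & 0 < dot (- z) g + t * (- (2^-1 * dot (- z) (Q22 P *m - z)))].
  have dg : 0 < dot (- z) g by rewrite dotNl -dotNr.
  have /near_nonneg_ray near1 : nonneg y := y0.
  near (0 : R)^'+ => t; exists t; split=> //.
    near: t; apply: near1 => i yi0; rewrite mxE oppr_ge0.
    by have := zJ i; rewrite trmx1 mul1mx; apply; apply/eqP.
  by near: t; exact: near_gt0_affine.
have Yt : inner_feasible P x (y + t *: - z).
  by split=> //; rewrite mulmxDr -scalemxAr mulmxN; rewrite trmxK in Bz;
     rewrite Bz oppr0 scaler0 addr0.
have := ymax _ Yt; rewrite objective_ray -/g -addrA gerDl leNgt => /negP; apply.
have -> : t * dot (- z) g - t ^+ 2 / 2 * dot (- z) (Q22 P *m - z) =
   t * (dot (- z) g + t * - (2^-1 * dot (- z) (Q22 P *m - z))) by field.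
exact: mulr_gt0.
Unshelve. all: by end_near. Qed.

(** * The outer problem *)

(** The derivative of [inner_dual] at [(x, y, l)] along [(d, w, mu)]. *)
Definition inner_dual_slope (x : 'cV[R]_n) (y : 'cV[R]_m) (l : 'cV[R]_q)
    (d : 'cV[R]_n) (w : 'cV[R]_m) (mu : 'cV[R]_q) : R :=
  dot d (Q11 P *m x + c_x P + (A_I P)^T *m l) + dot mu (A_I P *m x - b_I P)
  + dot w (Q22 P *m y).

Lemma inner_dual_ray x y l d w mu t : (Q11 P)^T = Q11 P ->
  inner_dual (x + t *: d) (y + t *: w) (l + t *: mu) =
    inner_dual x y l + t * (inner_dual_slope x y l d w mu
    + t * (2^-1 * dot d (Q11 P *m d) + dot mu (A_I P *m d)
           + 2^-1 * dot w (Q22 P *m w))).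
Proof.
have [symQ22 _] := psdQ22; move=> symQ11.
rewrite /inner_dual /inner_dual_slope !mulmxDr -!scalemxAr !dot_linear.
rewrite (dot_adjoint (Q22 P) y w) symQ22 (dotC (_ *m y) w).
rewrite (dot_adjoint (Q11 P) x d) symQ11 (dotC (_ *m x) d).
rewrite (dot_adjoint (A_I P) l d) (dotC (_ *m l) d) (dotC (c_x P) d).
by field.
Qed.

Lemma inner_slack_ray x y l d w mu t :
  inner_slack (x + t *: d) (y + t *: w) (l + t *: mu) =
    inner_slack x y l
    + t *: (Q22 P *m w - (Q12 P)^T *m d - (B_I P)^T *m mu).
Proof.
rewrite /inner_slack !mulmxDr -!scalemxAr !scalerBr !opprD.
by apply/colP => i; rewrite !mxE; ring.
Qed.

(** The hypotheses on [(d, w, mu)] keep [xb + t d] feasible and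
[(yb + t w, l + t mu)] dual feasible for small [t > 0]. Along this ray
[inner_dual] is thus an upper bound of the value function that is tight at
[t = 0]; a negative slope would contradict local optimality. *)
Lemma inner_dual_slope_ge0 xb yb l s d w mu : (Q11 P)^T = Q11 P ->
    (forall x, outer_feasible P x -> inner_argmax P x !=set0) ->
    local_solution P xb -> inner_KKT P xb yb l s ->
    A_O P *m d = 0 -> (forall i, xb i 0 = 0 -> 0 <= d i 0) ->
    (forall i, s i 0 = 0 ->
       0 <= (Q22 P *m w - (Q12 P)^T *m d - (B_I P)^T *m mu) i 0) ->
  0 <= inner_dual_slope xb yb l d w mu.
Proof.
move=> symQ11 argmax_nonempty [[AOx x0] xmin] kkt AOd d0 r0.
have sE := inner_KKT_slack kkt; have dE := inner_KKT_dual kkt.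
have [_ _ _ _ s0] := kkt.
rewrite leNgt; apply/negP => slope_lt0.
pose r := Q22 P *m w - (Q12 P)^T *m d - (B_I P)^T *m mu.
(* The second-order term of [inner_dual] along the ray. *)
pose kap := 2^-1 * dot d (Q11 P *m d) + dot mu (A_I P *m d)
           + 2^-1 * dot w (Q22 P *m w).
have [t [t0 xt0 st0 decr minx]] : exists t : R, [/\ 0 < t,
    nonneg (xb + t *: d), nonneg (s + t *: r),
    0 < - inner_dual_slope xb yb l d w mu + t * - kap
  & outer_feasible P (xb + t *: d) ->
      value_function P xb <= value_function P (xb + t *: d)].
  near (0 : R)^'+ => t; exists t; split=> //.
  - by near: t; exact: near_nonneg_ray.
  - by near: t; exact: near_nonneg_ray.
  - by near: t; apply: near_gt0_affine; rewrite oppr_gt0.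
  - by near: t; exact: near_ray xmin.
have Xt : outer_feasible P (xb + t *: d).
  by split=> //; rewrite mulmxDr -scalemxAr AOd scaler0 addr0.
have [yt ytmax] := argmax_nonempty _ Xt.
have := minx Xt.
rewrite (value_function_max ytmax).
rewrite (value_function_max (inner_KKT_argmax kkt)) -dE leNgt => /negP; apply.
have [ytY _] := ytmax.
have slack_t :
    nonneg (inner_slack (xb + t *: d) (yb + t *: w) (l + t *: mu)).
  by rewrite inner_slack_ray -sE.
apply: le_lt_trans (weak_duality ytY slack_t) _.
rewrite inner_dual_ray// -/kap gtrDl pmulr_rlt0//.
by rewrite -oppr_gt0 opprD -mulrN.
Unshelve. all: by end_near. Qed.

(** Farkas' lemma for the system in the unknowns [lO] (free), [y] and [sO]
(nonnegative, complementary to [s] and [x]). Its three blocks of rows are the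
outer gradient equation, the inner constraint and [Q22 y = Q22 y0]; a
certificate of infeasibility has the components [d], [mu] and [- w] on them,
and violates the hypothesis. Prescribing [Q22 y] rather than the optimality of
[y] is what keeps the system linear. *)
Lemma stationary_system_solvable (x : 'cV[R]_n) (y0 s : 'cV[R]_m)
    (l : 'cV[R]_q) :
    (forall (d : 'cV[R]_n) (w : 'cV[R]_m) (mu : 'cV[R]_q),
       A_O P *m d = 0 -> (forall i, x i 0 = 0 -> 0 <= d i 0) ->
       (forall i, s i 0 = 0 ->
          0 <= (Q22 P *m w - (Q12 P)^T *m d - (B_I P)^T *m mu) i 0) ->
       0 <= inner_dual_slope x y0 l d w mu) ->
  exists lO sO y, [/\
    Q11 P *m x + Q12 P *m y + c_x P + (A_I P)^T *m l + (A_O P)^T *m lO - sO = 0,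
    A_I P *m x + B_I P *m y = b_I P /\ Q22 P *m y = Q22 P *m y0,
    hadamard x sO = 0 /\ hadamard y s = 0,
    nonneg sO & nonneg y].
Proof.
have [symQ22 _] := psdQ22; move=> slope_ge0.
pose g0 := Q11 P *m x + c_x P + (A_I P)^T *m l.
pose J (j : 'I_(m + n)) :=
  match fintype.split j with inl i => s i 0 == 0 | inr i => x i 0 == 0 end.
have [[lO [z [z0 zJ E]]]|[z [Az zJ zb]]] :=
    farkas (col_mx (A_O P)^T (0 : 'M[R]_(q + m, p)))
           (block_mx (Q12 P) (- 1%:M) (col_mx (B_I P) (Q22 P)) 0) J
           (col_mx (- g0) (col_mx (b_I P - A_I P *m x) (Q22 P *m y0))).
  move: E; rewrite -{1}[z]vsubmxK mul_block_col !mul_col_mx !mul0mx addr0.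
  rewrite add_col_mx add0r => /eq_col_mx[E1 /eq_col_mx[E2 E3]].
  exists lO, (dsubmx z), (usubmx z); split.
  - move: E1; rewrite mulNmx mul1mx => /eqP; rewrite -subr_eq0 opprK => /eqP <-.
    by rewrite /g0; apply/colP => i; rewrite !mxE; ring.
  - by rewrite E2 addrC subrK.
  - split; apply/matrixP => i j; rewrite !mxE ord1.
      have [->|xi] := eqVneq (x i 0) 0; first by rewrite mul0r.
      by rewrite zJ ?mulr0// /J (unsplitK (inr i)).
    have [->|si] := eqVneq (s i 0) 0; first by rewrite mulr0.
    by rewrite zJ ?mul0r// /J (unsplitK (inl i)).
  - by move=> i; rewrite mxE.
  - by move=> i; rewrite mxE.
move: Az zJ zb; rewrite -[z]vsubmxK -[dsubmx z]vsubmxK.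
move: (usubmx z) (usubmx (dsubmx z)) (dsubmx (dsubmx z)) => d mu w.
rewrite tr_col_mx trmx0 mul_row_col mul0mx addr0 trmxK => AOd.
rewrite tr_block_mx mul_block_col trmx0 mul0mx addr0 tr_col_mx mul_row_col.
rewrite symQ22 linearN /= trmx1 mulNmx mul1mx => zJ zb.
exfalso.
have d0 i : x i 0 = 0 -> 0 <= d i 0.
  move=> xi; have := zJ (rshift m i); rewrite /J (unsplitK (inr i)) xi eqxx.
  by move/(_ isT); rewrite col_mxEd mxE oppr_le0.
have r0 i : s i 0 = 0 ->
    0 <= (Q22 P *m - w - (Q12 P)^T *m d - (B_I P)^T *m mu) i 0.
  move=> si; have := zJ (lshift n i); rewrite /J (unsplitK (inl i)) si eqxx.
  by move/(_ isT); rewrite col_mxEu mulmxN !mxE; lra.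
have := slope_ge0 d (- w) mu AOd d0 r0; rewrite leNgt => /negP; apply.
by move: zb; rewrite /inner_dual_slope -/g0 !dot_col_mx !dot_linear; lra.
Qed.

End Minmax.

Theorem corollary2p5 (R : realType) (n m p q : nat) (P : minmax_qp R n m p q)
    (lt_pn : (p < n)%N) (lt_qm : (q < m)%N)
    (psdQ11 : sym_psd (Q11 P)) (psdQ22 : sym_psd (Q22 P))
    (argmax_nonempty :
       forall x, outer_feasible P x -> inner_argmax P x !=set0)
    (xb : 'cV[R]_n) :
  local_solution P xb -> stationary P xb.
Proof.
move=> xmin; have [[AOx x0] _] := xmin; have [symQ11 _] := psdQ11.
have [y0 y0max] := argmax_nonempty xb (conj AOx x0).
have [l [s kkt]] := inner_multipliers psdQ22 y0max.
have [lO [sO [y [outerE [yE Qy] [xsO ys] sO0 y_ge0]]]] :=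
  stationary_system_solvable psdQ22 (fun d w mu =>
    @inner_dual_slope_ge0 _ _ _ _ _ _ psdQ22 xb y0 l s d w mu
      symQ11 argmax_nonempty xmin kkt).
have kkt_y : inner_KKT P xb y l s.
  case: kkt => kktE _ _ _ s0; split=> //; first by rewrite Qy.
  by rewrite yE subrr.
split=> //; exists y; first exact: inner_KKT_argmax kkt_y.
exists lO, sO, l, s; split=> //; split=> //.
by rewrite AOx subrr.
Qed.
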